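(* ${\sf SCAC}$ and $\omega\text{-}{\sf SCAC}$ are computably equivalent: ${\sf SCAC}\le_c\omega\text{-}{\sf SCAC}$ and $\omega\text{-}{\sf SCAC}\le_c{\sf SCAC}$.
   Context: A poset $(P,\le_P)$ consists of $P\subseteq\omega$ and a reflexive, antisymmetric, transitive relation $\le_P$; chains (antichains) are sets of pairwise comparable (incomparable) elements; it is $\omega$-ordered if $x\le_P y$ implies $x\le y$. In an infinite poset, $x$ is small if $x\le_P y$ for all but finitely many $y\in P$, large if $y\le_P x$ for all but finitely many $y$, isolated if $x$ is incomparable with all but finitely many $y$; the poset is stable if every element is small or isolated, or every element is large or isolated. ${\sf SCAC}$ is the problem whose instances are infinite stable posets with $P\subseteq\omega$ and whose solutions are infinite chains or infinite antichains of the instance; $\omega\text{-}{\sf SCAC}$ is its restriction to $\omega$-ordered instances. $\mathsf P\le_c\mathsf Q$ means: for every $\mathsf P$-instance $X$ there is a $\mathsf Q$-instance $\hat X\le_T X$ such that for every solution $\hat Y$ of $\hat X$ there is a solution $Y$ of $X$ with $Y\le_T X\oplus\hat Y$. *)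

(* Defs.v *)
From Stdlib Require Cantor.
From mathcomp Require Import all_boot.
From mathcomp Require Import boolp classical_sets cardinality.

Set Implicit Arguments.
Unset Strict Implicit.
Unset Printing Implicit Defensive.

Local Open Scope classical_set_scope.

(** Kleene's mu-recursive programs with an oracle, indexed by their arity. *)
Inductive oprog : nat -> Type :=
| Oracle : oprog 1
| Zero k : oprog k
| Succ : oprog 1
| Proj k (i : 'I_k) : oprog k
| Comp k m (f : oprog m) (g : 'I_m -> oprog k) : oprog k
| PrimRec k (f : oprog k) (g : oprog k.+2) : oprog k.+1
| Mu k (f : oprog k.+1) : oprog k.

(** Graph of the partial function defined by primitive recursion from the
    graphs [F] (base case) and [G] (step, fed with the counter, the previous
    value and the parameters). *)
Fixpoint prim_rec k (F : k.-tuple nat -> nat -> Prop)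
    (G : k.+2.-tuple nat -> nat -> Prop) (n : nat) (v : k.-tuple nat)
    (y : nat) : Prop :=
  if n is n'.+1 then
    exists2 z, prim_rec F G n' v z & G [tuple of n' :: z :: v] y
  else F v y.

(** [eval A p v y]: run on input [v] with oracle [A], the program [p] halts
    with output [y]. *)
Fixpoint eval (A : set nat) k (p : oprog k) : k.-tuple nat -> nat -> Prop :=
  match p in oprog k return k.-tuple nat -> nat -> Prop with
  | Oracle => fun v y => y = (thead v \in A)
  | Zero _ => fun _ y => y = 0
  | Succ => fun v y => y = (thead v).+1
  | Proj _ i => fun v y => y = tnth v i
  | Comp _ m f g => fun v y =>
      exists2 w : m.-tuple nat,
        (forall i, eval A (g i) v (tnth w i)) & eval A f w y
  | PrimRec _ f g => fun v y =>
      prim_rec (eval A f) (eval A g) (thead v) [tuple of behead v] y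
  | Mu _ f => fun v y =>
      eval A f [tuple of y :: v] 0 /\
      forall z, z < y -> exists w, eval A f [tuple of z :: v] w.+1
  end.

Definition turing_reducible (X Y : set nat) : Prop :=
  exists p : oprog 1, forall n, eval Y p [tuple n] (n \in X).

Notation "X <=T Y" := (turing_reducible X Y) (at level 70, no associativity).

Definition join (X Y : set nat) : set nat :=
  [set n | if odd n then Y n./2 else X n./2].

Record problem := Problem {
  instance : set nat -> Prop;
  solution : set nat -> set nat -> Prop  (* [solution X Y]: [Y] solves [X] *)
}.

Definition comp_reducible (P Q : problem) : Prop :=
  forall X, instance P X ->
  exists X', [/\ instance Q X', X' <=T X &
    forall Y', solution Q X' Y' ->
    exists2 Y, solution P X Y & Y <=T join X Y'].

Notation "P <=c Q" := (comp_reducible P Q) (at level 70, no associativity).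

(** A subset of the naturals codes a structure (P, <=_P) as the join of P and
    of the set of codes of pairs (x, y) with x <=_P y; since the pairing
    function is a bijection, every subset codes exactly one such structure. *)
Definition dom (X : set nat) : set nat := [set x | X x.*2].

Definition ple (X : set nat) (x y : nat) : Prop :=
  X (Cantor.to_nat (x, y)).*2.+1.

Definition poset (X : set nat) : Prop :=
  [/\ forall x y, ple X x y -> dom X x /\ dom X y,
      forall x, dom X x -> ple X x x,
      forall x y, ple X x y -> ple X y x -> x = y &
      forall x y z, ple X x y -> ple X y z -> ple X x z].

Definition comparable (X : set nat) (x y : nat) : Prop :=
  ple X x y \/ ple X y x.

Definition chain (X C : set nat) : Prop :=
  C `<=` dom X /\ forall x y, C x -> C y -> comparable X x y.

Definition antichain (X C : set nat) : Prop :=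
  C `<=` dom X /\ forall x y, C x -> C y -> x <> y -> ~ comparable X x y.

Definition omega_ordered (X : set nat) : Prop :=
  forall x y, ple X x y -> x <= y.

Definition small (X : set nat) (x : nat) : Prop :=
  finite_set [set y | dom X y /\ ~ ple X x y].

Definition large (X : set nat) (x : nat) : Prop :=
  finite_set [set y | dom X y /\ ~ ple X y x].

Definition isolated (X : set nat) (x : nat) : Prop :=
  finite_set [set y | dom X y /\ comparable X x y].

Definition stable (X : set nat) : Prop :=
  (forall x, dom X x -> small X x \/ isolated X x) \/
  (forall x, dom X x -> large X x \/ isolated X x).

Definition SCAC : problem := {|
  instance := fun X => [/\ poset X, infinite_set (dom X) & stable X];
  solution := fun X Y => infinite_set Y /\ (chain X Y \/ antichain X Y)
|}.

Definition omega_SCAC : problem := {|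
  instance := fun X => instance SCAC X /\ omega_ordered X;
  solution := solution SCAC
|}.

(* Main.v *)
(** Only the reduction to omega-SCAC has content.  If every element of P is
    small or isolated, let Q be P with [x <=_Q y] iff [x <= y] and [x <=_P y]:
    it is omega-ordered and again stable, and its chains are chains of P.  If Y
    is an infinite antichain of Q, the P-maximal elements of Y form an infinite
    antichain of P.  They are computable from P and Y, since elements of Y that
    are P-above [y] are numerically at most [y].  If every element of P is large
    or isolated, apply this to the dual of P. *)
From Stdlib Require Cantor.
From mathcomp Require Import all_boot.
From mathcomp Require Import boolp classical_sets cardinality.
Require Import Defs.

Set Implicit Arguments.
Unset Strict Implicit.
Unset Printing Implicit Defensive.

Local Open Scope classical_set_scope.

(** * Oracle-computable functions: closure properties and bounded quantifiers *)

Lemma tnth_behead_lift n T (t : n.+1.-tuple T) (i : 'I_n) :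
  tnth [tuple of behead t] i = tnth t (lift ord0 i).
Proof. by case/tupleP: t => x t; rewrite tnthS; congr tnth; apply: val_inj. Qed.

(** Only total functions are covered; predicates fall under it through the coercion of booleans to 0
    and 1. *)
Definition computable (A : set nat) k (f : k.-tuple nat -> nat) : Prop :=
  exists p : oprog k, forall v, eval A p v (f v).

Section Computable.
Variable A : set nat.
Local Notation cmp := (@computable A _).

Lemma computable_ext k (f g : k.-tuple nat -> nat) :
  f =1 g -> cmp f -> cmp g.
Proof. by move=> fg [p pP]; exists p => v; rewrite -fg. Qed.

Lemma computable_comp k m (f : m.-tuple nat -> nat)
    (g : 'I_m -> k.-tuple nat -> nat) :
  cmp f -> (forall i, cmp (g i)) -> cmp (fun v => f [tuple g i v | i < m]).
Proof.
move=> [p pP] /choice[q qP]; exists (Comp p q) => v /=.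
by exists [tuple g i v | i < m] => // i; rewrite tnth_mktuple.
Qed.

Lemma computable_succ k (f : k.-tuple nat -> nat) :
  cmp f -> cmp (fun v => (f v).+1).
Proof.
move=> [p pP]; exists (Comp Succ (fun=> p)) => v /=.
by exists [tuple f v] => // i; rewrite (tnth_nth 0) ord1.
Qed.

Lemma computable_const k c : cmp (fun _ : k.-tuple nat => c).
Proof.
by elim: c => [|c IH]; [exists (Zero k) | exact: computable_succ].
Qed.

Lemma computable_head k : cmp (fun v : k.+1.-tuple nat => thead v).
Proof. by exists (Proj ord0). Qed.

Lemma computable_behead k (f : k.-tuple nat -> nat) :
  cmp f -> cmp (fun v : k.+1.-tuple nat => f [tuple of behead v]).
Proof.
move=> cf; apply: computable_ext (computable_comp (k := k.+1)
  (g := fun i v => tnth v (lift ord0 i)) cf _) => [v|i]; last first.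
  by exists (Proj (lift ord0 i)).
by congr f; apply: eq_from_tnth => i; rewrite tnth_mktuple tnth_behead_lift.
Qed.

Lemma computable_subst k (f : k.+1.-tuple nat -> nat) (h : k.-tuple nat -> nat) :
  cmp f -> cmp h -> cmp (fun v => f [tuple of h v :: v]).
Proof.
move=> cf ch; apply: computable_ext (computable_comp
  (g := fun i v => tnth [tuple of h v :: v] i) cf _) => [v|i].
  by congr f; apply: eq_from_tnth => i; rewrite tnth_mktuple.
case: (unliftP ord0 i) => [j|] ->; last exact: ch.
by exists (Proj j) => v /=; rewrite tnthS.
Qed.

(** [PrimRec] treats the counter as the first coordinate of the input; [computable_subst] then puts
    [h v] in its place. Asking only for a recursion equation lets [F] be a function not literally
    defined by recursion on its first argument. *)
Lemma computable_rec k (F : nat -> k.-tuple nat -> nat)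
    (G : nat -> nat -> k.-tuple nat -> nat) (h : k.-tuple nat -> nat) :
    (forall n v, F n.+1 v = G n (F n v) v) ->
    cmp (F 0) ->
    cmp (fun w : k.+2.-tuple nat => G (thead w) (thead [tuple of behead w])
            [tuple of behead [tuple of behead w]]) ->
    cmp h ->
  cmp (fun v => F (h v) v).
Proof.
move=> FS [p pP] [q qP] ch.
have cF : cmp (fun w : k.+1.-tuple nat => F (thead w) [tuple of behead w]).
  exists (PrimRec p q) => v /=.
  elim: (thead v) => [|n IH] /=; first exact: pP.
  exists (F n [tuple of behead v]) => //.
  have := qP [tuple of n :: F n [tuple of behead v] :: [tuple of behead v]].
  rewrite FS; congr (eval _ _ _ (G _ _ _)).
  by apply: val_inj.
apply: computable_ext (computable_subst cF ch) => v.
by rewrite theadE; congr F; apply: val_inj.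
Qed.

Lemma computable_add k (f g : k.-tuple nat -> nat) :
  cmp f -> cmp g -> cmp (fun v => f v + g v).
Proof.
move=> cf cg; apply: (computable_rec (F := fun n v => f v + n)
  (G := fun _ z _ => z.+1)) cg => [n v||]; first by rewrite addnS.
- by apply: computable_ext cf => v; rewrite addn0.
- exact/computable_succ/computable_behead/computable_head.
Qed.

Lemma computable_pred k (f : k.-tuple nat -> nat) :
  cmp f -> cmp (fun v => (f v).-1).
Proof.
apply: (computable_rec (F := fun n _ => n.-1) (G := fun n _ _ => n)) => //.
- exact: computable_const.
- exact: computable_head.
Qed.

Lemma computable_sub k (f g : k.-tuple nat -> nat) :
  cmp f -> cmp g -> cmp (fun v => f v - g v).
Proof.
move=> cf cg; apply: (computable_rec (F := fun n v => f v - n)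
  (G := fun _ z _ => z.-1)) cg => [n v||]; first by rewrite subnS.
- by apply: computable_ext cf => v; rewrite subn0.
- exact/computable_pred/computable_behead/computable_head.
Qed.

Lemma computable_eq0 k (f : k.-tuple nat -> nat) :
  cmp f -> cmp (fun v => f v == 0).
Proof.
apply: (computable_rec (F := fun n _ => n == 0) (G := fun _ _ _ => 0)) => //;
  exact: computable_const.
Qed.

Lemma computable_neg k (p : k.-tuple nat -> bool) :
  cmp p -> cmp (fun v => ~~ p v).
Proof. by move=> /computable_eq0; apply: computable_ext => v; case: (p v). Qed.

Lemma computable_or k (p q : k.-tuple nat -> bool) :
  cmp p -> cmp q -> cmp (fun v => p v || q v).
Proof.
move=> cp cq; have := computable_neg (computable_eq0 (computable_add cp cq)).
by apply: computable_ext => v; case: (p v); case: (q v).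
Qed.

Lemma computable_and k (p q : k.-tuple nat -> bool) :
  cmp p -> cmp q -> cmp (fun v => p v && q v).
Proof.
move=> cp cq.
have := computable_neg (computable_or (computable_neg cp) (computable_neg cq)).
by apply: computable_ext => v; rewrite -negb_and negbK.
Qed.

Lemma computable_leq k (f g : k.-tuple nat -> nat) :
  cmp f -> cmp g -> cmp (fun v => f v <= g v).
(* By definition [m <= n] is [m - n == 0]. *)
Proof. by move=> cf cg; apply: computable_eq0; apply: computable_sub. Qed.

Lemma computable_eq k (f g : k.-tuple nat -> nat) :
  cmp f -> cmp g -> cmp (fun v => f v == g v).
Proof.
move=> cf cg.
have := computable_and (computable_leq cf cg) (computable_leq cg cf).
by apply: computable_ext => v; rewrite eqn_leq.
Qed.

Lemma computable_all k (p : nat -> k.-tuple nat -> bool) (h : k.-tuple nat -> nat) :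
    cmp (fun w : k.+1.-tuple nat => p (thead w) [tuple of behead w]) ->
    cmp h ->
  cmp (fun v => all (p^~ v) (iota 0 (h v))).
Proof.
move=> cp; apply: (computable_rec (F := fun n v => all (p^~ v) (iota 0 n))
  (G := fun n z v => (z != 0) && p n v)).
- move=> n v; rewrite -addn1 iotaD all_cat /= andbT add0n.
  by case: (all _ _).
- exact: computable_const.
apply: computable_and.
  exact/computable_neg/computable_eq0/computable_behead/computable_head.
(* The step function receives counter, accumulated truth value and parameters, while [p] reads only
   the counter and the parameters: this selection of coordinates skips the accumulator. *)
have := computable_comp (k := k.+2) (g := fun i v =>
  if unlift ord0 i is Some j then tnth v (lift ord0 (lift ord0 j)) else thead v)
  cp.
move=> H; apply: computable_ext (H _) => [w|i]; last first.
  case: (unliftP ord0 i) => [j|] _; last exact: computable_head.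
  by exists (Proj (lift ord0 (lift ord0 j))).
congr (nat_of_bool (p _ _)); first by rewrite /thead tnth_mktuple unlift_none.
by apply: eq_from_tnth => i; rewrite !tnth_behead_lift tnth_mktuple liftK.
Qed.

Lemma computable_has k (p : nat -> k.-tuple nat -> bool) (h : k.-tuple nat -> nat) :
    cmp (fun w : k.+1.-tuple nat => p (thead w) [tuple of behead w]) ->
    cmp h ->
  cmp (fun v => has (p^~ v) (iota 0 (h v))).
Proof.
move=> cp ch; have := computable_all (p := fun n v => ~~ p n v) (computable_neg cp) ch.
move=> /computable_neg; apply: computable_ext => v.
by rewrite -has_predC; congr nat_of_bool; apply: eq_has => n /=; rewrite negbK.
Qed.

Lemma computable_double k (f : k.-tuple nat -> nat) :
  cmp f -> cmp (fun v => (f v).*2).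
Proof.
by move=> cf; apply: computable_ext (computable_add cf cf) => v; rewrite addnn.
Qed.

Lemma computable_pair k (f g : k.-tuple nat -> nat) :
  cmp f -> cmp g -> cmp (fun v => Cantor.to_nat (f v, g v)).
Proof.
(* [Cantor.to_nat (x, y)] unfolds to [y] plus the triangular number of [y + x], and the latter is
   given by recursion. *)
move=> cf cg; apply: computable_add => //.
apply: (computable_rec (F := fun n _ =>
  PeanoNat.Nat.recursion 0 (fun i m => i.+1 + m) n)
  (G := fun n z _ => n.+1 + z)) => //.
- exact: computable_const.
- apply: computable_add; first exact/computable_succ/computable_head.
  exact/computable_behead/computable_head.
- exact: computable_add.
Qed.

Lemma computable_turing (X : set nat) :
  X <=T A <-> cmp (fun v : 1.-tuple nat => thead v \in X).
Proof.
split=> -[p pP]; exists p => v; last exact: (pP [tuple v]).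
have {1}-> : v = [tuple thead v] by apply: eq_from_tnth => i; rewrite ord1.
exact: pP.
Qed.

Lemma computable_mem (X : set nat) k (f : k.-tuple nat -> nat) :
  X <=T A -> cmp f -> cmp (fun v => f v \in X).
Proof.
move=> /computable_turing cX cf.
apply: computable_ext (computable_comp (g := fun=> f) cX (fun=> cf)) => v.
by rewrite /thead tnth_mktuple.
Qed.

End Computable.

(** * Turing reducibility and joins *)

Lemma turing_refl X : X <=T X.
Proof. by exists Oracle. Qed.


Lemma turing_joinl X Y : X <=T join X Y.
Proof.
apply/computable_turing.
have := computable_mem (turing_refl (join X Y))
  (computable_double (computable_head _ 0)).
apply: computable_ext => v; congr nat_of_bool.
by apply/asbool_equiv_eq; rewrite /join /= odd_double doubleK.
Qed.

Lemma turing_joinr X Y : Y <=T join X Y.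
Proof.
apply/computable_turing.
have := computable_mem (turing_refl (join X Y))
  (computable_succ (computable_double (computable_head _ 0))).
apply: computable_ext => v; congr nat_of_bool.
by apply/asbool_equiv_eq; rewrite /join /= odd_double /= uphalf_double.
Qed.

(** * Coding a domain and a relation as one set *)

Definition pair_code x y := (Cantor.to_nat (x, y)).*2.+1.

Lemma pair_code_inj x y x' y' :
  pair_code x y = pair_code x' y' -> x = x' /\ y = y'.
Proof. by case=> /double_inj e; case: (Cantor.to_nat_inj (x, y) (x', y') e). Qed.

(** Bounds the search for the components of a code; the Cantor pairing is at least the sum of its
    arguments. *)
Lemma leq_pair_code x y : (x <= pair_code x y) && (y <= pair_code x y).
Proof.
have /leP H := Cantor.to_nat_non_decreasing x y.
rewrite plusE in H; apply/andP; split; apply: leqW; rewrite -addnn;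
  apply: leq_trans (leq_addr _ _); apply: leq_trans H.
- exact: leq_addl.
- exact: leq_addr.
Qed.

Definition code_poset (D : set nat) (R : nat -> nat -> Prop) : set nat :=
  [set n | (exists2 x, n = x.*2 & D x) \/
           (exists x y, n = pair_code x y /\ R x y)].

Lemma dom_code_poset D R : dom (code_poset D R) = D.
Proof.
apply/seteqP; split=> x /=; last by left; exists x.
case=> [[y /double_inj ->]//|[y [z [/(congr1 odd)]]]].
by rewrite /= !odd_double.
Qed.

Lemma ple_code_poset D R x y : ple (code_poset D R) x y <-> R x y.
Proof.
split; last by move=> Rxy; right; exists x, y.
case=> [[z /(congr1 odd)]|[x' [y' [/pair_code_inj[-> ->]]]]//].
by rewrite /= !odd_double.
Qed.

Lemma computable_dom A X k (f : k.-tuple nat -> nat) :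
  X <=T A -> computable A f -> computable A (fun v => f v \in dom X).
Proof. by move=> XA cf; apply: (computable_mem XA (computable_double cf)). Qed.

Lemma computable_ple A X k (f g : k.-tuple nat -> nat) :
  X <=T A -> computable A f -> computable A g ->
  computable A (fun v => `[< ple X (f v) (g v) >]).
Proof.
move=> XA cf cg; apply: (computable_mem XA).
exact/computable_succ/computable_double/computable_pair.
Qed.

(** Computability of [R] is assumed after substitution of arbitrary computable functions, the shape
    in which [computable_ple] delivers it. *)
Lemma turing_code_poset A D (R : nat -> nat -> Prop) :
    D <=T A ->
    (forall k (f g : k.-tuple nat -> nat), computable A f -> computable A g ->
      computable A (fun v => `[< R (f v) (g v) >])) ->
  code_poset D R <=T A.
Proof.
move=> DA cR; apply/computable_turing.
(* Codes are decoded by bounded search, which avoids computing the inverse of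
   the pairing function. *)
pose P n := has (fun x => (n == x.*2) && (x \in D)) (iota 0 n.+1) ||
  has (fun x => has (fun y => (n == pair_code x y) && `[< R x y >])
    (iota 0 n.+1)) (iota 0 n.+1).
have c0 k : computable A (fun v : k.+1.-tuple nat => thead v).
  exact: computable_head.
apply: (@computable_ext _ _ (fun v => P (thead v))).
  move=> v; rewrite /P; set n := thead v; congr nat_of_bool.
  apply/idP/idP; rewrite inE.
    case/orP=> /hasP[x _].
      by case/andP=> /eqP nx /set_mem Dx; left; exists x.
    by case/hasP=> y _ /andP[/eqP nxy /asboolP Rxy]; right; exists x, y.
  case=> [[x nx Dx]|[x [y [nxy Rxy]]]]; apply/orP; [left|right].
    apply/hasP; exists x; last by rewrite nx eqxx /=; exact: mem_set.
    by rewrite mem_iota /= ltnS nx -addnn leq_addr.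
  have := leq_pair_code x y; rewrite -nxy => /andP[lex ley].
  apply/hasP; exists x; first by rewrite mem_iota.
  apply/hasP; exists y; first by rewrite mem_iota.
  by rewrite nxy eqxx; apply/asboolP.
apply: computable_or.
  apply: (computable_has (p := fun x v => (thead v == x.*2) && (x \in D)));
    last exact: computable_succ.
  apply: computable_and; last exact: computable_mem.
  apply: computable_eq; last exact: computable_double.
  exact: computable_behead.
apply: (computable_has (p := fun x v => has (fun y =>
    (thead v == pair_code x y) && `[< R x y >]) (iota 0 (thead v).+1)));
  last exact: computable_succ.
(* In the inner search the parameter tuple [w] holds the candidate [x] first and the number to be
   decoded second. *)
apply: (computable_has (p := fun y (w : 2.-tuple nat) =>
    (thead [tuple of behead w] == pair_code (thead w) y) && `[< R (thead w) y >]));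
  last exact/computable_succ/computable_behead.
apply: computable_and.
  apply: computable_eq; first exact: (computable_behead (computable_behead (c0 0))).
  apply: computable_succ; apply: computable_double; apply: computable_pair => //.
  exact: computable_behead.
by apply: cR => //; apply: computable_behead.
Qed.

(** * The dual, the omega-ordered part and the maximal elements, computably in the data *)

Definition dual (X : set nat) : set nat :=
  code_poset (dom X) (fun x y => ple X y x).

(** An arbitrary oracle [A] in place of [X] lets such reductions be chained without appeal to
    transitivity of [<=T]. *)
Lemma turing_dual A X : X <=T A -> dual X <=T A.
Proof.
move=> XA; apply: turing_code_poset => [|k f g cf cg].
  exact/computable_turing/computable_dom/computable_head.
exact: computable_ple.
Qed.

Definition omega_part (X : set nat) : set nat :=
  code_poset (dom X) (fun x y => x <= y /\ ple X x y).

Lemma turing_omega_part A X : X <=T A -> omega_part X <=T A.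
Proof.
move=> XA; apply: turing_code_poset => [|k f g cf cg].
  exact/computable_turing/computable_dom/computable_head.
have := computable_and (computable_leq cf cg) (computable_ple XA cf cg).
apply: computable_ext => v; congr nat_of_bool.
by apply/andP/asboolP => -[H /asboolP].
Qed.

(** Testing only [z < y] makes the condition a bounded quantifier. If [Y] is an antichain of
    [omega_part X], strict upper bounds of [y] within [Y] are numerically smaller, so these are
    exactly the maximal elements of [Y] in the order of [X]. *)
Definition maximals (X Y : set nat) : set nat :=
  [set y | Y y /\ forall z, z < y -> Y z -> ~ ple X y z].

Lemma turing_maximals A X Y : X <=T A -> Y <=T A -> maximals X Y <=T A.
Proof.
move=> XA YA; apply/computable_turing.
have c0 k : computable A (fun v : k.+1.-tuple nat => thead v).
  exact: computable_head.
have c1 : computable A (fun w : 2.-tuple nat => thead [tuple of behead w]).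
  exact: computable_behead.
have := computable_and (computable_mem YA (c0 0)) (computable_all
  (p := fun z v => ~~ ((z \in Y) && `[< ple X (thead v) z >]))
  (computable_neg (computable_and (computable_mem YA (c0 1))
     (computable_ple XA c1 (c0 1)))) (c0 0)).
apply: computable_ext => v; congr nat_of_bool.
apply/andP/idP => [[/set_mem Yy H]|/set_mem[Yy H]].
  apply: mem_set; split=> // z lt_z Yz le_z.
  have := allP H z; rewrite mem_iota => /(_ lt_z).
  by rewrite (mem_set Yz) /= => /asboolP.
split; first exact: mem_set.
apply/allP => z; rewrite mem_iota => /= lt_z; apply/negP.
by case/andP=> /set_mem Yz /asboolP; apply: H.
Qed.

(** * Chains and antichains of the omega-ordered part *)

Lemma infinite_avoid (Y F : set nat) :
  infinite_set Y -> finite_set F -> exists2 y, Y y & ~ F y.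
Proof.
move=> infY finF; apply: contrapT => H; apply: infY.
by apply: sub_finite_set finF => y Yy; apply: contrapT => nFy; apply: H; exists y.
Qed.

(** The new order is the intersection of two partial orders. For a small [x], the only further
    elements that fail to be above it are the finitely many [y < x]; an isolated element gains no
    comparabilities. *)
Lemma omega_part_instance X :
    poset X -> infinite_set (dom X) ->
    (forall x, dom X x -> small X x \/ isolated X x) ->
  instance omega_SCAC (omega_part X).
Proof.
move=> [pd pr pa pt] infX st.
have leQ x y : ple (omega_part X) x y <-> x <= y /\ ple X x y.
  exact: ple_code_poset.
have domQ : dom (omega_part X) = dom X by exact: dom_code_poset.
split; last by move=> x y /leQ[].
split; rewrite ?domQ //.
  split; rewrite ?domQ.
  - by move=> x y /leQ[_ /pd].
  - by move=> x Xx; apply/leQ; split=> //; apply: pr.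
  - by move=> x y /leQ[_ xy] /leQ[_ yx]; apply: pa.
  - move=> x y z /leQ[xy Xxy] /leQ[yz Xyz]; apply/leQ; split.
      exact: leq_trans yz.
    exact: pt Xyz.
left=> x; rewrite domQ => /st[sx|ix]; [left|right].
  have := finite_II x; rewrite /small domQ => finx.
  apply: sub_finite_set (_ : finite_set (_ `|` _)).
    2: by rewrite finite_setU; split; [exact: sx | exact: finx].
  move=> y [Xy nle] /=; case: (leqP x y) => xy; [left|by right].
  by split=> // Xxy; apply: nle; apply/leQ.
rewrite /isolated domQ; apply: sub_finite_set ix => y [Xy xy]; split=> //.
by case: xy => /leQ[_]; [left|right].
Qed.

Lemma chain_omega_part X Y : chain (omega_part X) Y -> chain X Y.
Proof.
rewrite /chain dom_code_poset => -[YX H]; split=> // x y Yx Yy.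
by case: (H x y Yx Yy) => /ple_code_poset[_]; [left|right].
Qed.

(** For [x < y] in [Y], having [x] below [y] in [X] would make them comparable in [omega_part X],
    and having [y] below [x] would contradict the maximality of [y]. *)
Lemma antichain_maximals X Y :
  antichain (omega_part X) Y -> antichain X (maximals X Y).
Proof.
rewrite /antichain dom_code_poset => -[YX H]; split=> [x [/YX]//|].
have nle x y : Y x -> Y y -> x < y -> ~ ple X x y.
  move=> Yx Yy xy le_xy; apply: (H x y) => //; first by apply/eqP; rewrite ltn_eqF.
  by left; apply/ple_code_poset; split=> //; apply: ltnW.
move=> x y [Yx mx] [Yy my] /eqP; rewrite neq_ltn => /orP[]xy [].
- exact: nle.
- exact: my.
- exact: mx.
- exact: nle.
Qed.

(* In an antichain [Y] of the omega-ordered part, strict upper bounds in [X] are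
   numerically smaller, so every element of [Y] lies below a maximal one; as
   maximal elements are isolated, finitely many of them cannot cover [Y]. *)
Lemma infinite_maximals X Y :
    poset X -> (forall x, dom X x -> small X x \/ isolated X x) ->
    infinite_set Y -> antichain (omega_part X) Y ->
  infinite_set (maximals X Y).
Proof.
move=> [pd pr pa pt] st infY; rewrite /antichain dom_code_poset => -[YX H] finM.
(* If [x] were small, the infinite set [Y] would contain some [y] above [x] in [X]. Avoiding the
   numbers up to [x] as well gives [x < y], so the two are distinct and comparable in
   [omega_part X]. *)
have iso x : Y x -> isolated X x.
  move=> Yx; case: (st x (YX x Yx)) => // sx; exfalso.
  have : finite_set ([set y | dom X y /\ ~ ple X x y] `|` [set m | m < x.+1]).
    by rewrite finite_setU; split; [exact: sx | exact: finite_II].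
  move=> /(infinite_avoid infY)[y Yy /not_orP[le_xy /negP]].
  rewrite -leqNgt => xy.
  apply: (H x y) => //; first by apply/eqP; rewrite ltn_eqF.
  left; apply/ple_code_poset; split; first exact: ltnW.
  by apply: contrapT => nle; apply: le_xy; split=> //; apply: YX.
apply: infY; apply: (sub_finite_set (B := \bigcup_(z in maximals X Y)
  [set y | dom X y /\ comparable X z y])).
  suff below y : Y y -> exists2 z, maximals X Y z & ple X y z.
    move=> y Yy; have [z Mz le_yz] := below y Yy; exists z => //.
    by split; [exact: YX | right].
  (* Strong induction applies because climbing in [X] from a non-maximal [y] to another element of
     [Y] descends numerically. *)
  elim/ltn_ind: y => y IH Yy; case: (pselect (maximals X Y y)) => [My|nM].
    by exists y => //; apply/pr/YX.
  have [z [lt_zy [Yz le_yz]]] : exists z, z < y /\ Y z /\ ple X y z.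
    apply: contrapT => nex; apply: nM; split=> // z zy Yz le_yz.
    by apply: nex; exists z.
  have [m Mm le_zm] := IH z lt_zy Yz.
  by exists m => //; apply: pt le_zm.
by apply: bigcup_finite => // z [Yz _]; apply: iso.
Qed.

(** The bound is stated for every oracle computing [X] and [Y'] because the lemma is also applied to
    a dual poset, where the oracle is the join of the original poset with [Y']. *)
Lemma omega_part_solution X Y' :
    poset X -> (forall x, dom X x -> small X x \/ isolated X x) ->
    solution SCAC (omega_part X) Y' ->
  exists2 Y, solution SCAC X Y &
    forall A, X <=T A -> Y' <=T A -> Y <=T A.
Proof.
move=> pX st [infY [chY|aY]].
  by exists Y' => //; split=> //; left; apply: chain_omega_part.
exists (maximals X Y'); last by move=> A; apply: turing_maximals.
split; first exact: infinite_maximals.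
by right; apply: antichain_maximals.
Qed.

(** * Order reversal and the two reductions *)

Lemma dom_dual X : dom (dual X) = dom X.
Proof. exact: dom_code_poset. Qed.

Lemma ple_dual X x y : ple (dual X) x y <-> ple X y x.
Proof. exact: ple_code_poset. Qed.

Lemma comparable_dual X x y : comparable (dual X) x y <-> comparable X x y.
Proof. by split=> -[] /ple_dual; [right|left|right|left]. Qed.

Lemma poset_dual X : poset X -> poset (dual X).
Proof.
move=> [pd pr pa pt]; split; rewrite ?dom_dual.
- by move=> x y /ple_dual /pd[].
- by move=> x /pr; rewrite ple_dual.
- by move=> x y /ple_dual yx /ple_dual xy; apply: pa.
- by move=> x y z /ple_dual yx /ple_dual zy; apply/ple_dual/(pt _ _ _ zy).
Qed.

Lemma small_dual X x : large X x -> small (dual X) x.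
Proof.
apply: sub_finite_set => y; rewrite /= dom_dual => -[Xy nle]; split=> //.
by move=> le_yx; apply: nle; apply/ple_dual.
Qed.

Lemma isolated_dual X x : isolated X x -> isolated (dual X) x.
Proof.
by apply: sub_finite_set => y; rewrite /= dom_dual => -[Xy /comparable_dual].
Qed.

(** Chains and antichains depend only on comparability, which reversal preserves. *)
Lemma solution_dual X Y : solution SCAC (dual X) Y -> solution SCAC X Y.
Proof.
move=> [infY [] []]; rewrite dom_dual => YX H; split=> //; [left|right];
  split=> // x y Yx Yy.
- by apply/comparable_dual; apply: H.
- by move=> xy /comparable_dual; apply: H.
Qed.

Theorem theorem6 : (SCAC <=c omega_SCAC) /\ (omega_SCAC <=c SCAC).
Proof.
split=> X; last first.
  (* An omega-ordered instance is already an instance of [SCAC] with the same solutions, so [X] and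
     [Y'] serve unchanged. *)
  move=> [iX _]; exists X; split=> // [|Y' sY']; first exact: turing_refl.
  by exists Y' => //; apply: turing_joinr.
move=> [pX infX [st|st]].
  exists (omega_part X); split; first exact: omega_part_instance.
    exact/turing_omega_part/turing_refl.
  move=> Y' /(omega_part_solution pX st)[Y sY YT]; exists Y => //.
  by apply: YT; [apply: turing_joinl | apply: turing_joinr].
have pD := poset_dual pX.
have stD x : dom (dual X) x -> small (dual X) x \/ isolated (dual X) x.
  rewrite dom_dual => /st[/small_dual|/isolated_dual]; [by left | by right].
exists (omega_part (dual X)); split.
- by apply: omega_part_instance stD; rewrite ?dom_dual.
- exact/turing_omega_part/turing_dual/turing_refl.
- move=> Y' /(omega_part_solution pD stD)[Y sY YT].
  exists Y; first exact: solution_dual.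
  by apply: YT; [apply/turing_dual/turing_joinl | apply: turing_joinr].
Qed.
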